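(* Let $G=(V,E)$ have $n\ge2$ vertices and at least one edge, let $\lambda^*=\rho(G)$, let $T\ge1$ be an integer and $\tau>0$. Set $R=(n+\tau)/\lambda^*$, $\nu=\tau/(R\lambda^* )$, $\eta=\sqrt{\log(n)/T}$ and $\alpha=8R\sqrt{\log(n)/T}$. Run the following procedure (Noisy-Order-Packing-MWU): let $w^{(1)}_v=1$ for all $v\in V$; for $t=1,\dots,T$: let $p^{(t)}_v=w^{(t)}_v/\sum_u w^{(t)}_u$; let $\sigma^{(t)}$ be the ordering of $V$ in nonincreasing order of $p^{(t)}$, ties broken by a fixed order on $V$; for each $v$ let $\hat m^{(t)}_v\sim N\big(\tfrac1R(1-q(\sigma^{(t)})_v/\lambda^* ),\nu^2\big)$ independently; set $w^{(t+1)}_v=w^{(t)}_v\exp(-\eta\hat m^{(t)}_v)$. Finally choose $t$ uniformly at random from $[T]$ and return $(p^{(t)},\sigma^{(t)})$. Then the returned $\sigma$ is the ordering of $V$ in nonincreasing order of the returned $p$, and with probability at least $1/2$ (over the noise and the choice of $t$), $\rho(S^*_\sigma)\ge(1-2\alpha)\lambda^*$.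
   Context: For nonempty $S\subseteq V$, $\rho(S)=|E(S)|/|S|$ with $E(S)$ the edges inside $S$, and $\rho(G)=\max_{\emptyset\ne S\subseteq V}\rho(S)$. For an ordering $\sigma$ of $V$ and $v\in V$, $q(\sigma)_v=|\{\{u,v\}\in E: u \text{ precedes } v \text{ in }\sigma\}|$; $S^\sigma_x$ is the set of vertices equal to or preceding $x$ in $\sigma$, and $S^*_\sigma$ is a prefix $S^\sigma_x$ of maximum density. $\log$ is the natural logarithm. *)

(* Defs.v *)
From HB Require Import structures.
From mathcomp Require Import all_boot all_order all_algebra.
From mathcomp Require Import all_classical all_reals all_analysis.
Set Implicit Arguments. Unset Strict Implicit. Unset Printing Implicit Defensive.
Import Order.TTheory GRing.Theory Num.Theory.
Local Open Scope ring_scope.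

(* A simple graph: a symmetric irreflexive relation e on a finite vertex type V. *)
Section Graph.
Variables (R : realType) (V : finType) (e : rel V).

Definition edgesIn (S : {set V}) : {set {set V}} :=
  [set f : {set V} | (f \subset S) && [exists u, exists v, e u v && (f == [set u; v])]].

Definition density (S : {set V}) : R := (#|edgesIn S|)%:R / (#|S|)%:R.

Definition maxDensity : R := \big[Num.max/0]_(S : {set V} | S != finset.set0) density S.

(* An ordering sigma of V is a duplicate-free list enumerating V. *)
Definition qord (s : seq V) (v : V) : nat :=
  #|[set u | e u v & (index u s < index v s)%N]|.

Definition prefixSet (s : seq V) (x : V) : {set V} :=
  [set y | (index y s <= index x s)%N].

Definition isMaxPrefix (s : seq V) (S : {set V}) : Prop :=
  (exists x, S = prefixSet s x) /\ (forall x, density (prefixSet s x) <= density S).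

Definition orderBy (rk : V -> nat) (p : V -> R) : seq V :=
  sort (fun u v => (p v < p u) || ((p u == p v) && (rk u <= rk v)%N)) (enum V).

Definition normalize (w : V -> R) : V -> R := fun v => w v / \sum_u w u.

(* Noisy-Order-Packing-MWU.  Rounds are indexed 0..T-1 (paper: 1..T).
   z t v is the standard-normal noise of round t at vertex v, so that
   hat m^(t)_v = (1/Rr)(1 - q(sigma^(t))_v / lam) + nu * z t v ~ N(., nu^2). *)
Definition mhat (lam Rr nu : R) (s : seq V) (v : V) (zv : R) : R :=
  Rr^-1 * (1 - (qord s v)%:R / lam) + nu * zv.

Fixpoint mwuWeights (rk : V -> nat) (lam Rr nu eta : R) (z : nat -> V -> R)
    (t : nat) : V -> R :=
  match t with
  | 0 => fun _ => 1
  | t'.+1 =>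
      let w := mwuWeights rk lam Rr nu eta z t' in
      let s := orderBy rk (normalize w) in
      fun v => w v * expR (- (eta * mhat lam Rr nu s v (z t' v)))
  end.

Definition mwuP rk lam Rr nu eta z t : V -> R :=
  normalize (mwuWeights rk lam Rr nu eta z t).
Definition mwuSigma rk lam Rr nu eta z t : seq V :=
  orderBy rk (mwuP rk lam Rr nu eta z t).

End Graph.

Local Open Scope classical_set_scope.
Definition mutually_independent {d} {Omega : measurableType d} {R : realType}
    (P : probability Omega R) (I : finType) (X : I -> Omega -> R) : Prop :=
  forall (J : {set I}) (B : I -> set R), (forall i, measurable (B i)) ->
    P [set w | forall i, i \in J -> B i (X i w)] =
    (\prod_(i in J) P [set w | B i (X i w)])%E.

(* Main.v *)
Require Import Defs.
From HB Require Import structures.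
From mathcomp Require Import all_boot all_order all_algebra.
From mathcomp Require Import all_classical all_reals all_analysis.
From mathcomp Require Import measurable_realfun ring lra.
Import Order.TTheory GRing.Theory Num.Theory.
Local Open Scope ring_scope.

(** Against the uniform distribution on a densest set, every order has
nonpositive expected cost, since each inner edge is charged to one of its
endpoints; against [p] itself, Abel summation over the prefixes of [sigma]
shows that the expected cost is at least [(1 - rho(S*_sigma) / lam) / Rr].
The usual potential argument bounds the difference of the two costs: using
[ln x <= x - 1] for the update factor of each round and [1 + x <= expR x] for
the noise seen by the comparison distribution, it becomes a pathwise
inequality all of whose terms are nonnegative.  Its expectation is computed
from the independence of the noise of round [t] and the earlier rounds and
from the moment generating function of the normal law, which bounds the
number of bad rounds. *)

Set Implicit Arguments.
Unset Strict Implicit.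

(** * Orders by nonincreasing weight *)

Lemma orderBy_perm (R : realType) (V : finType) (rk : V -> nat) (p : V -> R) :
  perm_eq (orderBy rk p) (enum V).
Proof. by rewrite /orderBy perm_sort. Qed.

Lemma orderBy_sorted (R : realType) (V : finType) (rk : V -> nat) (p : V -> R) :
  sorted (fun u v => p v <= p u) (orderBy rk p).
Proof.
rewrite /orderBy; set leT := fun u v => _ || _.
apply: (@sub_sorted _ leT).
  by move=> u v /orP[/ltW//|/andP[/eqP-> _]]; exact: lexx.
apply: sort_sorted => u v; rewrite /leT eq_sym.
by case: (ltgtP (p u) (p v)) => //= _; exact: leq_total.
Qed.

(** * Counting edges at their later endpoint *)

Section EdgeCounting.
Variables (V : finType) (e : rel V).
Hypotheses (e_sym : symmetric e) (e_irr : irreflexive e).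
Variable s : seq V.

Let backPairs (S : {set V}) : {set V * V} :=
  [set uv | [&& uv.2 \in S, e uv.1 uv.2 & (index uv.1 s < index uv.2 s)%N]].

Let sum_qordE (S : {set V}) :
  (\sum_(v in S) qord e s v = #|backPairs S|)%N.
Proof.
under eq_bigr => v _ do rewrite /qord -sum1_card.
rewrite (exchange_big_dep xpredT)//= pair_big_dep -sum1_card.
by apply: eq_bigl => -[u v]; rewrite !inE.
Qed.

(** A prefix is closed under passing to earlier vertices, so a backward pair that ends in it is an
    edge inside it. The unordered edge determines the pair, because swapping the endpoints would
    reverse their order. *)
Lemma sum_qord_prefix_le (x : V) :
  (\sum_(v in prefixSet s x) qord e s v <= #|edgesIn e (prefixSet s x)|)%N.
Proof.
rewrite sum_qordE.
rewrite -(@card_in_imset _ _ (fun uv => [set uv.1; uv.2])).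
  apply/subset_leq_card/fintype.subsetP => _ /imsetP[[u v] /[!inE]/= /and3P[vx uv iuv] ->].
  apply/andP; split; last first.
    by apply/existsP; exists u; apply/existsP; exists v; rewrite uv eqxx.
  apply/fintype.subsetP => w; rewrite !inE => /orP[] /eqP-> //.
  exact: leq_trans (ltnW iuv) vx.
move=> [u v] [u' v'] /[!inE]/= /and3P[_ uv iuv] /and3P[_ uv' iuv'] /setP E.
have := E u; have := E v; rewrite !inE !eqxx orbT /=.
move=> /esym/orP[] /eqP vE /esym/orP[] /eqP uE; subst => //.
- by rewrite ltnn in iuv.
- by have := ltn_trans iuv iuv'; rewrite ltnn.
- by rewrite ltnn in iuv.
Qed.

(** Orienting an inner edge from its earlier to its later endpoint gives a backward pair. For an
    arbitrary [S] the sum also counts edges that enter [S] from outside, hence only an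
    inequality. *)
Lemma edgesIn_le_sum_qord (S : {set V}) : (forall x, x \in s) ->
  (#|edgesIn e S| <= \sum_(v in S) qord e s v)%N.
Proof.
move=> s_all; rewrite sum_qordE.
apply: leq_trans (leq_imset_card (fun uv => [set uv.1; uv.2]) _).
apply/subset_leq_card/fintype.subsetP => f; rewrite inE => /andP[fS].
move=> /existsP[u /existsP[v /andP[uv /eqP fE]]]; subst f.
have [uS vS] : u \in S /\ v \in S.
  by split; apply: (fintype.subsetP fS); rewrite !inE eqxx ?orbT.
have [iuv|ivu|/index_inj E] := ltngtP (index u s) (index v s).
- by apply/imsetP; exists (u, v); rewrite ?inE//= vS uv iuv.
- apply/imsetP; exists (v, u); rewrite ?inE/= ?uS ?ivu 1?e_sym ?uv//.
  by rewrite finset.setUC.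
- by rewrite (E u (s_all u) (s_all v)) e_irr in uv.
Qed.

Lemma qord_le (v : V) : (qord e s v <= #|V|)%N.
Proof. exact: max_card. Qed.

End EdgeCounting.

(** Abel summation by induction on the last entry: the part before [x] has a nonnegative sum, so its
    weight may be lowered from that of the preceding entry to [p x]. Keeping the last weight on the
    left is what makes the induction close. *)
Lemma sorted_weighted_sum_ge_last (R : realType) (V : eqType) (p a : V -> R)
    (s : seq V) (x : V) :
  sorted (fun u v => p v <= p u) (rcons s x) ->
  (forall k, (k <= (size s).+1)%N -> 0 <= \sum_(v <- take k (rcons s x)) a v) ->
  p x * (\sum_(v <- rcons s x) a v) <= \sum_(v <- rcons s x) p v * a v.
Proof.
have tr : transitive (fun u v => p v <= p u).
  by move=> ? ? ? ab bc; exact: le_trans bc ab.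
move: s x; apply: last_ind => [|s y IH] x srt pre; first by rewrite /= !big_seq1.
rewrite -!(cats1 (rcons s y) x) !big_cat/= !big_seq1 mulrDr lerD2r.
have srt' : sorted (fun u v => p v <= p u) (rcons s y).
  by move: srt; rewrite -cats1 => /(subseq_sorted tr (prefix_subseq _ _)).
apply: le_trans (IH y srt' _).
  apply: ler_wpM2r.
    have := pre (size (rcons s y)); rewrite -[rcons _ x]cats1 take_size_cat//.
    by apply; rewrite ltnW.
  move: srt; rewrite -!cats1 -catA => /(subseq_sorted tr (suffix_subseq _ _)).
  by move=> /= /andP[].
move=> k ks; have := pre k; rewrite -[rcons _ x]cats1 takel_cat ?size_rcons// => -> //.
exact: leq_trans ks _.
Qed.

Lemma sorted_weighted_sum_ge0 (R : realType) (V : eqType) (p a : V -> R) (s : seq V) :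
  (forall v, 0 <= p v) -> sorted (fun u v => p v <= p u) s ->
  (forall k, (k <= size s)%N -> 0 <= \sum_(v <- take k s) a v) ->
  0 <= \sum_(v <- s) p v * a v.
Proof.
move=> p0; move: s; apply: last_ind => [|s x _] srt pre; first by rewrite big_nil.
rewrite size_rcons in pre.
apply: le_trans (sorted_weighted_sum_ge_last srt pre).
by rewrite mulr_ge0//; have := pre _ (leqnn _); rewrite -(size_rcons s x) take_size.
Qed.

(** * Densest sets and prefixes *)

Section Density.
Variables (R : realType) (V : finType) (e : rel V).
Hypotheses (e_sym : symmetric e) (e_irr : irreflexive e).
Local Notation density := (@density R V e).
Local Notation lam := (@maxDensity R V e).

Lemma density_ge0 (S : {set V}) : 0 <= density S.
Proof. by rewrite divr_ge0. Qed.

Lemma density_le_max (S : {set V}) : S != finset.set0 -> density S <= lam.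
Proof. by move=> S0; rewrite /maxDensity; apply: le_bigmax_cond. Qed.

Lemma prefixSet_neq0 (s : seq V) x : prefixSet s x != finset.set0.
Proof. by apply/set0Pn; exists x; rewrite inE. Qed.

Lemma maxDensity_attained (v0 : V) : exists2 S, S != finset.set0 & density S = lam.
Proof.
have S0 : [set v0] != finset.set0 :> {set V} by apply/set0Pn; exists v0; rewrite inE.
rewrite /maxDensity (@bigmax_eq_arg _ _ _ _ [set v0])//; last first.
  by move=> S _; exact: density_ge0.
by case: arg_maxP => // S SN0 _; exists S.
Qed.

Lemma maxDensity_gt0 (u v : V) : e u v -> 0 < lam.
Proof.
move=> uv; have S0 : [set u; v] != finset.set0.
  by apply/set0Pn; exists u; rewrite !inE eqxx.
apply: lt_le_trans (density_le_max S0).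
rewrite divr_gt0// ltr0n card_gt0//; apply/set0Pn; exists [set u; v].
rewrite inE fintype.subxx/=.
by apply/existsP; exists u; apply/existsP; exists v; rewrite uv eqxx.
Qed.

(** By Abel summation it suffices that [D] minus the back-degree has nonnegative sum over each
    prefix, and there the back-degrees add up to at most the number of inner edges, which is at most
    [D] times the size. *)
Lemma prefix_density_sum (s : seq V) (p : V -> R) (D : R) :
  perm_eq s (enum V) -> (forall v, 0 <= p v) ->
  sorted (fun u v => p v <= p u) s ->
  (forall x, density (prefixSet s x) <= D) ->
  0 <= \sum_v p v * (D - (qord e s v)%:R).
Proof.
move=> sV p0 srt HD.
have us : uniq s by rewrite (perm_uniq sV) enum_uniq.
have -> : \sum_v p v * (D - (qord e s v)%:R) = \sum_(v <- s) p v * (D - (qord e s v)%:R).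
  by rewrite (perm_big _ sV)/= big_enum.
apply: sorted_weighted_sum_ge0 => // -[|k] ks; first by rewrite take0 big_nil.
(* The list is nonempty, so its head can serve as the default of [nth]. The first [k.+1] entries
   form the prefix that ends at entry [k]. *)
have x0 : V by case: (s) ks.
pose x := nth x0 s k.
have E : prefixSet s x = [set v in take k.+1 s].
  apply/setP => y; rewrite !inE index_uniq//.
  by rewrite in_take ?(perm_mem sV) ?mem_enum.
have card : #|prefixSet s x| = k.+1.
  by rewrite E cardsE (card_uniqP _) ?take_uniq// size_takel.
rewrite (eq_bigl (fun v => true))// big_uniq ?take_uniq//=.
rewrite (eq_bigl (mem (prefixSet s x))); last by move=> v; rewrite /= E inE.
rewrite sumrB sumr_const card subr_ge0 -natr_sum.
apply: (@le_trans _ _ (#|edgesIn e (prefixSet s x)|%:R)).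
  by rewrite ler_nat sum_qord_prefix_le.
by have := HD x; rewrite /Defs.density card ler_pdivrMr ?ltr0n// mulr_natr.
Qed.

(* Witness: the uniform distribution on a densest set. *)
Lemma densest_weights (v0 : V) : exists c : V -> R,
  [/\ forall v, 0 <= c v, \sum_v c v = 1 &
   forall s : seq V, (forall x, x \in s) ->
     \sum_v c v * (lam - (qord e s v)%:R) <= 0].
Proof.
have [S S0 SE] := maxDensity_attained v0.
have c0 : 0 < #|S|%:R :> R by rewrite ltr0n card_gt0.
have cE (F : V -> R) : \sum_v (if v \in S then #|S|%:R^-1 else 0) * F v =
    #|S|%:R^-1 * \sum_(v in S) F v.
  rewrite mulr_sumr [RHS]big_mkcond/=.
  by apply: eq_bigr => v _; case: ifP => // _; rewrite mul0r.
exists (fun v => if v \in S then #|S|%:R^-1 else 0); split.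
- by move=> v; case: ifP => // _; rewrite invr_ge0 ltW.
- have := cE (fun=> 1); under eq_bigr do rewrite mulr1.
  by rewrite sumr_const mulVf ?gt_eqF.
- move=> s s_all; rewrite cE pmulr_rle0 ?invr_gt0//.
  rewrite sumrB sumr_const subr_le0 -natr_sum -SE /Defs.density.
  rewrite -[leLHS]mulr_natr divfK ?gt_eqF//.
  by rewrite ler_nat edgesIn_le_sum_qord.
Qed.

(** A crude bound, from back-degrees along [enum V]; it serves to keep the costs between -1 and
    1. *)
Lemma maxDensity_le_card (v0 : V) : lam <= #|V|%:R.
Proof.
have [S S0 <-] := maxDensity_attained v0.
rewrite /Defs.density ler_pdivrMr ?ltr0n ?card_gt0// -natrM ler_nat.
have enumE x : x \in enum V by rewrite mem_enum.
apply: leq_trans (edgesIn_le_sum_qord e_sym e_irr S enumE) _.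
rewrite mulnC -sum_nat_const.
by apply: leq_sum => v _; exact: qord_le.
Qed.

End Density.

(** From [1 - x <= expR (- x)] follows [expR x * (1 - x) <= 1], while [(1 + x + 2 * x ^+ 2) * (1 -
    x) = 1 + x ^+ 2 * (1 - 2 * x)] is at least 1. *)
Lemma expR_le_quadratic (R : realType) (x : R) : x <= 2^-1 ->
  expR x <= 1 + x + 2 * x ^+ 2.
Proof.
move=> x2; have : (expR x)^-1 >= 1 - x by rewrite -expRN expR_ge1Dx.
have := expR_gt0 x; set E := expR x => E0 H.
have E1 : E * (1 - x) <= 1 by rewrite mulrC -ler_pdivlMr// mul1r.
have x1 : 0 < 1 - x by lra.
rewrite -(ler_pM2r x1); apply: le_trans E1 _.
have : 0 <= x ^+ 2 * (1 - 2 * x) by rewrite mulr_ge0 ?sqr_ge0//; lra.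
by lra.
Qed.

(** * Regret of exponential weights with arbitrary real costs *)

Section ExponentialWeights.
Variables (R : realType) (V : finType) (v0 : V) (eta : R).
Variables (W m : nat -> V -> R).
Hypotheses (W0 : forall v, W 0%N v = 1)
  (WS : forall t v, W t.+1 v = W t v * expR (- (eta * m t v))).

Lemma expWeights_gt0 t v : 0 < W t v.
Proof.
by elim: t => [|t IH]; rewrite ?W0 ?ltr01// WS mulr_gt0// expR_gt0.
Qed.

Lemma expWeights_sum_gt0 t : 0 < \sum_v W t v.
Proof.
rewrite (bigD1 v0)//= ltr_pwDl ?expWeights_gt0//.
by apply: sumr_ge0 => v _; rewrite ltW ?expWeights_gt0.
Qed.

Lemma normalize_sum1 t : \sum_v normalize (W t) v = 1.
Proof. by rewrite /normalize -mulr_suml divff// gt_eqF ?expWeights_sum_gt0. Qed.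

Lemma normalize_ge0 t v : 0 <= normalize (W t) v.
Proof. by rewrite /normalize ltW// divr_gt0 ?expWeights_gt0 ?expWeights_sum_gt0. Qed.

Lemma ln_expWeights T v : ln (W T v) = - (eta * \sum_(t < T) m t v).
Proof.
elim: T => [|T IH]; first by rewrite big_ord0 mulr0 oppr0 W0 ln1.
rewrite WS lnM ?posrE ?expWeights_gt0 ?expR_gt0// IH expRK big_ord_recr/=.
by rewrite mulrDr opprD.
Qed.

(** The total weight is multiplied in each round by the average [Q] of the update factors, and
    [ln Q <= Q - 1]. Removing the logarithm leaves a sum of terms whose expectation can be
    computed. *)
Lemma ln_sum_expWeights T : ln (\sum_v W T v) <=
  ln #|V|%:R + \sum_(t < T)
     (\sum_v normalize (W t) v * expR (- (eta * m t v)) - 1).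
Proof.
elim: T => [|T IH].
  rewrite big_ord0 addr0 (eq_bigr (fun=> 1)) => [|v _]; last by rewrite W0.
  by rewrite sumr_const.
rewrite big_ord_recr/= addrA.
have S0 := expWeights_sum_gt0 T.
set Q := \sum_v normalize (W T) v * _.
have -> : \sum_v W T.+1 v = (\sum_v W T v) * Q.
  rewrite /Q mulr_sumr; apply: eq_bigr => v _.
  by rewrite WS /normalize mulrA mulrCA divff ?gt_eqF// mulr1.
have Q0 : 0 < Q.
  rewrite /Q (bigD1 v0)//= ltr_pwDl//.
    by rewrite mulr_gt0 ?expR_gt0// divr_gt0// expWeights_gt0.
  by apply: sumr_ge0 => v _; rewrite mulr_ge0 ?normalize_ge0 ?expR_ge0.
rewrite lnM ?posrE// lerD//.
have := @le_ln1Dx R (Q - 1); rewrite [1 + _]addrC subrK; apply.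
by lra.
Qed.

(** Each single weight is at most the total weight; the logarithms of these inequalities are
    averaged with respect to [c]. *)
Lemma expWeights_regret T (c : V -> R) :
  (forall v, 0 <= c v) -> \sum_v c v = 1 ->
  - (eta * \sum_(t < T) \sum_v c v * m t v) <=
  ln #|V|%:R + \sum_(t < T)
     (\sum_v normalize (W t) v * expR (- (eta * m t v)) - 1).
Proof.
move=> c0 c1; apply: le_trans (ln_sum_expWeights T).
rewrite -[leRHS]mul1r -c1 mulr_suml exchange_big/= mulr_sumr -sumrN.
apply: ler_sum => v _; rewrite -mulr_sumr mulrCA -mulrN.
apply: ler_wpM2l => //; rewrite -ln_expWeights.
rewrite ler_ln ?posrE ?expWeights_gt0 ?expWeights_sum_gt0//.
rewrite (bigD1 v)//= lerDl; apply: sumr_ge0 => u _.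
by rewrite ltW ?expWeights_gt0.
Qed.

End ExponentialWeights.

Local Open Scope classical_set_scope.


(** * Moment generating function of the standard normal law *)

Section NormalMgf.
Variable R : realType.
Local Notation mu := lebesgue_measure.

(** The Radon-Nikodym derivative with respect to Lebesgue measure agrees almost everywhere with the
    explicit density, since both have the same integral over every measurable set. *)
Lemma ge0_integral_normal_prob (m s : R) (f : R -> \bar R) :
  measurable_fun setT f -> (forall x, 0 <= f x)%E ->
  (\int[normal_prob m s]_x f x = \int[mu]_x (f x * (normal_pdf m s x)%:E))%E.
Proof.
move=> mf f0; have dom := normal_prob_dominates m s.
rewrite -(Radon_Nikodym_SigmaFinite.change_of_variables dom)//.
have mpdf : measurable_fun setT (EFin \o normal_pdf m s : measurableTypeR R -> \bar R).
  by apply/measurable_EFinP; exact: measurable_normal_pdf.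
have irn := Radon_Nikodym_SigmaFinite.f_integrable dom.
apply: ae_eq_integral => //.
- by apply: emeasurable_funM => //; exact: measurable_int irn.
- exact: emeasurable_funM.
- apply: ae_eqe_mul2l; apply: integral_ae_eq => // A _ mA.
  by rewrite -Radon_Nikodym_SigmaFinite.f_integral.
Qed.

(* Completing the square: e^(sx) times the N(0,1) density is e^(s^2/2) times
   the N(s,1) density. *)
Lemma normal_mgf (s : R) :
  (\int[normal_prob 0 1]_x (expR (s * x))%:E = (expR (s ^+ 2 / 2))%:E)%E.
Proof.
rewrite ge0_integral_normal_prob; last 2 first.
- apply/measurable_EFinP; exact: measurableT_comp.
- by move=> x; rewrite lee_fin expR_ge0.
under eq_integral => x _.
  rewrite -EFinM normal_pdfE ?oner_eq0// /normal_fun mulrCA -expRD.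
  have -> : s * x + - (x - 0) ^+ 2 / (1 ^+ 2 *+ 2) =
      s ^+ 2 / 2 + - (x - s) ^+ 2 / (1 ^+ 2 *+ 2).
    by rewrite expr1n subr0; field.
  rewrite expRD mulrCA.
  rewrite -[X in (_ * X)%:E]/(normal_peak 1 * normal_fun s 1 x).
  have <- : normal_pdf s 1 x = normal_peak 1 * normal_fun s 1 x.
    by rewrite normal_pdfE ?oner_eq0.
  rewrite EFinM.
  over.
rewrite ge0_integralZl//.
- by rewrite integral_normal_pdf mule1.
- by apply/measurable_EFinP; exact: measurable_normal_pdf.
- by move=> x _; rewrite lee_fin normal_pdf_ge0.
Qed.

Lemma standard_normal_mgf d (Omega : measurableType d) (P : probability Omega R)
    (X : {RV P >-> R}) (s : R) :
  (forall A : set R, measurable A -> distribution P X A = normal_prob 0 1 A) ->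
  (\int[P]_w (expR (s * X w))%:E = (expR (s ^+ 2 / 2))%:E)%E.
Proof.
move=> XN; rewrite -normal_mgf.
transitivity (\int[distribution P X]_x (expR (s * x))%:E)%E.
  rewrite ge0_integral_distribution//.
  - by apply/measurable_EFinP; exact: measurableT_comp.
(* Lebesgue measure lives on a copy of R with another measurability display. *)
pose idR : measurableTypeR R -> R := idfun.
have midR : measurable_fun setT idR by move=> _ A mA; rewrite setTI; exact: mA.
transitivity (\int[pushforward (normal_prob 0 1) idR]_x (expR (s * x))%:E)%E.
  by apply: eq_measure_integral => A mA _; exact: XN.
rewrite ge0_integral_pushforward//.
by apply/measurable_EFinP; exact: measurableT_comp.
Qed.

End NormalMgf.

(** * Independence of one variable from a family of others *)

Section Independence.
Context d (Omega : measurableType d) (R : realType) (P : probability Omega R).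

Section Cylinders.
Variables (I : finType) (X : I -> {RV P >-> R}).

(** A pi-system generating the sigma-algebra of the variables with index in [J]. *)
Definition cylinders (J : {set I}) : set (set Omega) :=
  [set C | exists2 B : I -> set R, (forall i, measurable (B i)) &
     C = [set w | forall i, i \in J -> B i (X i w)]].

Lemma cylinders_setI_closed (J : {set I}) : setI_closed (cylinders J).
Proof.
move=> _ _ [B mB ->] [B' mB' ->]; exists (fun i => B i `&` B' i).
  by move=> i; exact: measurableI.
apply/seteqP; split=> w /=; first by move=> [H H'] i iJ; split; [exact: H|exact: H'].
by move=> H; split=> i iJ; have [] := H i iJ.
Qed.

Lemma cylinder_measurable (J : {set I}) C : cylinders J C -> measurable C.
Proof.
move=> [B mB ->].
have -> : [set w | forall i, i \in J -> B i (X i w)] =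
    \bigcap_(i in [set` J]) (X i @^-1` B i) by [].
apply: fin_bigcap_measurable; first exact: finite_finset.
by move=> i _; rewrite -[_ @^-1` _]setTI; exact: measurable_funP.
Qed.

Lemma sigma_cylinders_measurable (J : {set I}) A :
  <<s cylinders J >> A -> measurable A.
Proof.
apply: smallest_sub; first exact: sigma_algebra_measurable.
by move=> C; exact: cylinder_measurable.
Qed.

Lemma sigma_cylinders_RV (J : {set I}) (i : I) (B : set R) :
  i \in J -> measurable B -> <<s cylinders J >> (X i @^-1` B).
Proof.
move=> iJ mB; apply: sub_sigma_algebra.
exists (fun j => if j == i then B else setT).
  by move=> j; case: ifP.
apply/seteqP; split=> w /=; first by move=> Bw j _; case: eqP => [->|].
by move=> /(_ i iJ); rewrite eqxx.
Qed.

Hypothesis X_indep : mutually_independent P (fun i => X i : Omega -> R).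

(** Dynkin's argument: the events satisfying the product rule are closed under complements and
    countable disjoint unions, and they contain the cylinders by mutual independence. *)
Lemma indep_sigma_cylinders (J : {set I}) (i : I) (A : set Omega) (B : set R) :
  i \notin J -> <<s cylinders J >> A -> measurable B ->
  P (A `&` X i @^-1` B) = (P A * P (X i @^-1` B))%E.
Proof.
move=> iJ sA mB; set E := X i @^-1` B.
have mE : measurable E by rewrite -[E]setTI; exact: measurable_funP.
pose good (A : set Omega) := P (A `&` E) = (P A * P E)%E.
have fin C : measurable C -> P C \is a fin_num by exact: fin_num_measure.
have goodC C : measurable C -> good C -> good (~` C).
  move=> mC gC; have mC' : measurable (~` C) by exact: measurableC.
  rewrite /good probability_setC// muleBl ?mul1e; last 2 first.
  + exact: fin.
  + by rewrite fin_num_adde_defl// fin_numN fin.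
  rewrite -gC setIC -setDE measureD//; last by rewrite -ge0_fin_numE// fin.
  by rewrite setIC.
have goodU (F : (set Omega)^nat) : (forall n, measurable (F n)) ->
    trivIset setT F -> (forall n, good (F n)) -> good (\bigcup_k F k).
  move=> mF tF gF; rewrite /good setI_bigcupl measure_bigcup//; last 2 first.
  + by move=> n _; exact: measurableI.
  + exact: trivIset_setIr.
  rewrite measure_bigcup// muleC -(fineK (fin _ mE)) -nneseriesZl//.
  by apply: eq_eseriesr => n _; rewrite fineK ?fin// muleC; exact: gF.
apply: (@dynkin_induction _ (g_sigma_algebraType (cylinders J)) (cylinders J) good)
  sA => //.
- exact: cylinders_setI_closed.
- by rewrite /good setTI probability_setT mul1e.
- move=> _ [C mC ->]; rewrite /good.
  (* Since [i] is outside [J], placing [B] at index [i] turns the intersection with [E] into a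
     single cylinder over [i |: J]. *)
  pose C' j := if j == i then B else C j.
  have mC' j : measurable (C' j) by rewrite /C'; case: ifP.
  have := X_indep (i |: J) mC'.
  have -> : [set w | forall j, j \in (i |: J)%SET -> C' j (X j w)] =
      [set w | forall j, j \in J -> C j (X j w)] `&` E.
    apply/seteqP; split=> w /=.
      move=> H; split=> [j jJ|].
        have := H j; rewrite !inE jJ orbT /C' => /(_ isT).
        by case: eqP => // ji; rewrite ji (negbTE iJ) in jJ.
      by have := H i; rewrite !inE eqxx /C' eqxx; exact.
    move=> [H Ew] j; rewrite !inE /C'; case: eqP => [->//|_] /=; exact: H.
  move=> ->; rewrite big_setU1//= /C' eqxx muleC; congr (_ * _)%E.
  rewrite (X_indep J mC); apply: eq_bigr => j jJ.
  by case: eqP => // ji; rewrite ji (negbTE iJ) in jJ.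
- by move=> C /sigma_cylinders_measurable mC; exact: goodC.
- move=> F mF; apply: goodU => n.
  exact: sigma_cylinders_measurable (mF n).
Qed.

End Cylinders.

(** The product rule identifies the joint law with the product of the two laws, and Tonelli's
    theorem splits the integral. *)
Let ge0_expectation_mul_indep_RV (X Y : {RV P >-> R}) :
  (forall w, 0 <= X w) -> (forall w, 0 <= Y w) ->
  (forall A B : set R, measurable A -> measurable B ->
     P (X @^-1` A `&` Y @^-1` B) = (P (X @^-1` A) * P (Y @^-1` B))%E) ->
  (\int[P]_w (X w * Y w)%:E = (\int[P]_w (X w)%:E) * (\int[P]_w (Y w)%:E))%E.
Proof.
move=> X0 Y0 XY.
pose XY_ w := (X w, Y w).
have mXY : measurable_fun setT XY_ by exact: measurable_fun_pair.
(* Absolute values make the integrand nonnegative on the whole plane without changing it at the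
   values of [X] and [Y]. *)
pose f (xy : R * R) := (`|xy.1| * `|xy.2|)%:E.
have mf : measurable_fun setT f.
  apply/measurable_EFinP; apply: measurable_funM.
    by apply: measurableT_comp => //; exact: measurable_fst.
  by apply: measurableT_comp => //; exact: measurable_snd.
have f0 z : (0 <= f z)%E by rewrite lee_fin mulr_ge0.
transitivity (\int[P]_w (f \o XY_) w)%E.
  by apply: eq_integral => w _; rewrite /f/= !ger0_norm.
transitivity (\int[pushforward P XY_]_z f z)%E.
  by rewrite ge0_integral_pushforward.
transitivity (\int[distribution P X \x distribution P Y]_z f z)%E.
  apply: eq_measure_integral => C mC _; apply/esym.
  by apply: product_measure_unique => // A B mA mB; exact: XY.
rewrite fubini_tonelli1//.
have nX : (\int[distribution P X]_x `|x|%:E = \int[P]_w (X w)%:E)%E.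
  rewrite ge0_integral_distribution//; last exact/measurable_EFinP.
  by apply: eq_integral => w _; rewrite /= ger0_norm.
have nY : (\int[distribution P Y]_x `|x|%:E = \int[P]_w (Y w)%:E)%E.
  rewrite ge0_integral_distribution//; last exact/measurable_EFinP.
  by apply: eq_integral => w _; rewrite /= ger0_norm.
rewrite -nX -nY -ge0_integralZr//; last 2 first.
- exact/measurable_EFinP.
- exact: integral_ge0.
apply: eq_integral => x _; rewrite /fubini_F /f/=.
under eq_integral do rewrite EFinM.
by rewrite ge0_integralZl//; exact/measurable_EFinP.
Qed.

Lemma ge0_expectation_mul_indep (X Y : Omega -> R) :
  measurable_fun setT X -> measurable_fun setT Y ->
  (forall w, 0 <= X w) -> (forall w, 0 <= Y w) ->
  (forall A B : set R, measurable A -> measurable B ->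
     P (X @^-1` A `&` Y @^-1` B) = (P (X @^-1` A) * P (Y @^-1` B))%E) ->
  (\int[P]_w (X w * Y w)%:E = (\int[P]_w (X w)%:E) * (\int[P]_w (Y w)%:E))%E.
Proof.
move=> mX mY.
pose X' : {RV P >-> R} := HB.pack X (isMeasurableFun.Build _ _ _ _ _ mX).
pose Y' : {RV P >-> R} := HB.pack Y (isMeasurableFun.Build _ _ _ _ _ mY).
exact: (@ge0_expectation_mul_indep_RV X' Y').
Qed.

End Independence.

(** * Measurability of the process *)

Section ProcessMeasurability.
Context d (T : measurableType d) (R : realType) (V : finType).

(* The ordering is a function of the finite table of pairwise comparisons. *)
Lemma orderBy_measurable (rk : V -> nat) (p : T -> V -> R) (Q : set (seq V)) :
  (forall v, measurable_fun setT (p ^~ v)) ->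
  measurable [set w | Q (orderBy rk (p w))].
Proof.
move=> mp.
pose leb w (uv : V * V) := (p w uv.2 < p w uv.1) ||
  ((p w uv.1 == p w uv.2) && (rk uv.1 <= rk uv.2)%N).
pose table w := [ffun uv => leb w uv].
pose Q' (c : {ffun V * V -> bool}) := Q (sort (fun u v => c (u, v)) (enum V)).
have -> : [set w | Q (orderBy rk (p w))] = table @^-1` Q'.
  apply/funext => w; rewrite /= /Q' /orderBy; congr (Q (sort _ _)).
  by apply/funext => u; apply/funext => v; rewrite ffunE.
have -> : table @^-1` Q' =
    \bigcup_(c in Q') \bigcap_(uv in setT) (leb ^~ uv @^-1` [set c uv]).
  apply/seteqP; split=> w /=.
    by move=> Qw; exists (table w) => // uv _ /=; rewrite ffunE.
  move=> [c Qc cw]; suff -> : table w = c by [].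
  by apply/ffunP => uv; rewrite ffunE; exact: cw.
apply: fin_bigcup_measurable; first exact: finite_finset.
move=> c _; apply: fin_bigcap_measurable; first exact: finite_finset.
move=> uv _; rewrite -[X in measurable X]setTI.
suff m : measurable_fun setT (leb ^~ uv) by exact: m.
apply: measurable_or; first exact: measurable_fun_ltr.
by apply: measurable_and; [exact: measurable_fun_eqr|exact: measurable_cst].
Qed.

Variables (e : rel V) (rk : V -> nat) (lam Rr nu eta : R).
Variable z : T -> nat -> V -> R.
Local Notation W w := (mwuWeights e rk lam Rr nu eta (z w)).
Local Notation p w := (mwuP e rk lam Rr nu eta (z w)).
Local Notation sigma w := (mwuSigma e rk lam Rr nu eta (z w)).

Lemma measurable_normalize (u : T -> V -> R) :
  (forall w v, 0 < u w v) -> (forall v, measurable_fun setT (u ^~ v)) ->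
  forall v, measurable_fun setT (fun w => normalize (u w) v).
Proof.
move=> u0 mu v.
(* The total is positive, so its inverse can be written with [expR] and [ln], both measurable. *)
have -> : (fun w => normalize (u w) v) =
    (fun w => u w v * expR (- ln (\sum_x u w x))).
  apply/funext => w; rewrite /normalize expRN lnK// posrE.
  by rewrite (bigD1 v)//= ltr_pwDl//; apply: sumr_ge0 => x _; exact: ltW.
apply: measurable_funM => //; apply: measurableT_comp => //.
apply: measurableT_comp => //; apply: measurableT_comp => //.
exact: measurable_sum.
Qed.

Lemma measurable_qord (u : T -> V -> R) (v : V) :
  (forall v, measurable_fun setT (u ^~ v)) ->
  measurable_fun setT (fun w => (qord e (orderBy rk (u w)) v)%:R : R).
Proof.
move=> mu _ B mB; rewrite setTI.
exact: (orderBy_measurable rk (fun s => B (qord e s v)%:R) mu).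
Qed.

Lemma mwuWeights_gt0 w t v : 0 < W w t v.
Proof.
by elim: t v => [|t IH] v; rewrite ?ltr01//= mulr_gt0// expR_gt0.
Qed.

(** The domain is arbitrary and only the noise before round [t] is assumed measurable. Taking for
    the domain the sigma-algebra generated by the earlier noise therefore shows that the process is
    adapted. *)
Lemma measurable_mwuWeights t :
  (forall s v, (s < t)%N -> measurable_fun setT (fun w => z w s v)) ->
  forall v, measurable_fun setT (fun w => W w t v).
Proof.
elim: t => [|t IH] mz v; first exact: measurable_cst.
have mW : forall v, measurable_fun setT (fun w => W w t v).
  by apply: IH => s u st; apply: mz; exact: ltnW.
have mp := measurable_normalize (fun w => @mwuWeights_gt0 w t) mW.
apply: measurable_funM => //; apply: measurableT_comp => //.
apply: measurableT_comp => //; apply: measurable_funM => //.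
apply: measurable_funD; last by apply: measurable_funM => //; exact: mz.
apply: measurable_funM => //; apply: measurable_funB => //.
by apply: measurable_funM => //; exact: measurable_qord.
Qed.

Variable t : nat.
Hypothesis mz : forall s v, (s < t)%N -> measurable_fun setT (fun w => z w s v).

Lemma measurable_mwuP v : measurable_fun setT (fun w => p w t v).
Proof.
apply: measurable_normalize; first by move=> w u; exact: mwuWeights_gt0.
exact: measurable_mwuWeights.
Qed.

Lemma measurable_mwuSigma (Q : set (seq V)) : measurable [set w | Q (sigma w t)].
Proof. by apply: orderBy_measurable; exact: measurable_mwuP. Qed.

Lemma measurable_qord_mwuSigma v :
  measurable_fun setT (fun w => (qord e (sigma w t) v)%:R : R).
Proof. by apply: measurable_qord; exact: measurable_mwuP. Qed.

End ProcessMeasurability.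

(** * Inequalities for a fixed realization of the noise *)

Section PathwiseBounds.
Variables (R : realType) (V : finType) (e : rel V).
Hypotheses (e_sym : symmetric e) (e_irr : irreflexive e).
Variables (rk : V -> nat) (v0 : V) (Rr nu eta : R).
Local Notation n := (#|V|%:R : R).
Local Notation lam := (@maxDensity R V e).
Hypotheses (lam_gt0 : 0 < lam) (Rr_gt0 : 0 < Rr) (Rr_large : n <= Rr * lam).
Hypotheses (eta_gt0 : 0 < eta) (eta_small : eta <= 16^-1).

Definition meanCost (s : seq V) (v : V) : R :=
  Rr^-1 * (1 - (qord e s v)%:R / lam).

Lemma meanCostE s v : meanCost s v = (Rr * lam)^-1 * (lam - (qord e s v)%:R).
Proof. by rewrite /meanCost; field; rewrite !gt_eqF. Qed.

(** Both [lam] and the back-degree lie between 0 and [n], so they differ by at most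
    [n <= Rr * lam]. *)
Lemma meanCost_le1 s v : `|meanCost s v| <= 1.
Proof.
have RL : 0 < Rr * lam by rewrite mulr_gt0.
rewrite meanCostE normrM (gtr0_norm (_ : 0 < (Rr * lam)^-1)) ?invr_gt0//.
rewrite ler_pdivrMl// mulr1.
apply: le_trans Rr_large.
have q0 : 0 <= (qord e s v)%:R :> R by [].
have qn : (qord e s v)%:R <= n by rewrite ler_nat qord_le.
have ln := maxDensity_le_card R e_sym e_irr v0.
have := lam_gt0.
by rewrite ler_norml; lra.
Qed.

(** The quadratic bound on [expR] makes the update affine in the cost, whose average is then bounded
    below by Abel summation. The bound [D] will be [lam] in good rounds and the largest prefix
    density in bad ones. *)
Lemma round_update_le (s : seq V) (p : V -> R) (D : R) :
  perm_eq s (enum V) -> sorted (fun u v => p v <= p u) s ->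
  (forall v, 0 <= p v) -> \sum_v p v = 1 ->
  (forall x, density R e (prefixSet s x) <= D) ->
  \sum_v p v * expR (- (eta * meanCost s v)) <=
  1 + 2 * eta ^+ 2 - eta * (Rr * lam)^-1 * (lam - D).
Proof.
move=> sV srt p0 p1 HD.
apply: (@le_trans _ _ (\sum_v p v * (1 + 2 * eta ^+ 2 - eta * meanCost s v))).
  apply: ler_sum => v _; apply: ler_wpM2l => //.
  have := meanCost_le1 s v; set m := meanCost s v => /[!ler_norml] /andP[m1 m2].
  have em1 : - eta <= eta * m by have := ler_wpM2l (ltW eta_gt0) m1; rewrite mulrN1.
  have em2 : eta * m <= eta by have := ler_wpM2l (ltW eta_gt0) m2; rewrite mulr1.
  have h : - (eta * m) <= 2^-1.
    by have := eta_small; lra.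
  apply: le_trans (expR_le_quadratic h) _.
  have : (- (eta * m)) ^+ 2 <= eta ^+ 2.
    by rewrite sqrrN -subr_ge0 subr_sqr mulr_ge0//; lra.
  by lra.
have := prefix_density_sum sV p0 srt HD.
set X := \sum_v _ => X0.
have XE : X = D - \sum_v p v * (qord e s v)%:R.
  by rewrite /X; under eq_bigr do rewrite mulrBr; rewrite sumrB -mulr_suml p1 mul1r.
have -> : \sum_v p v * (1 + 2 * eta ^+ 2 - eta * meanCost s v) =
    (1 + 2 * eta ^+ 2) - eta * (Rr * lam)^-1 * (lam - \sum_v p v * (qord e s v)%:R).
  under eq_bigr => v _.
    rewrite (_ : _ * _ = p v * (1 + 2 * eta ^+ 2) - eta * (Rr * lam)^-1 *
      (p v * lam - p v * (qord e s v)%:R)); last by rewrite meanCostE; ring.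
    over.
  by rewrite sumrB -mulr_suml -mulr_sumr sumrB -mulr_suml p1 !mul1r.
rewrite lerD2l lerN2; apply: ler_wpM2l; last by lra.
by rewrite mulr_ge0 ?invr_ge0 ?mulr_ge0// ltW.
Qed.

Variable z : nat -> V -> R.
Local Notation W := (mwuWeights e rk lam Rr nu eta z).
Local Notation p := (mwuP e rk lam Rr nu eta z).
Local Notation sigma := (mwuSigma e rk lam Rr nu eta z).

Lemma mwuP_ge0 t v : 0 <= p t v.
Proof. exact: (normalize_ge0 v0 (W := W)). Qed.

Lemma mwuP_sum1 t : \sum_v p t v = 1.
Proof. exact: (normalize_sum1 v0 (W := W)). Qed.

(** Each round contributes two units to [2 * T]: one from [ln x <= x - 1], one from
    [1 + x <= expR x] applied to the noise weighted by [c]. In this form every summand over the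
    rounds is nonnegative and can be integrated termwise. *)
Lemma mwu_pathwise_regret T (c : V -> R) :
  (forall v, 0 <= c v) -> \sum_v c v = 1 ->
  (forall s : seq V, (forall x, x \in s) ->
     \sum_v c v * (lam - (qord e s v)%:R) <= 0) ->
  2 * T%:R <= ln n + \sum_(t < T) (\sum_v c v * expR (eta * nu * z t v) +
    \sum_v p t v * expR (- (eta * meanCost (sigma t) v)) *
      expR (- (eta * nu) * z t v)).
Proof.
move=> c0 c1 copt.
pose m t v := mhat e lam Rr nu (sigma t) v (z t v).
have WS t v : W t.+1 v = W t v * expR (- (eta * m t v)) by [].
have := expWeights_regret v0 (fun=> erefl) WS T c0 c1.
have lower t : 1 - \sum_v c v * expR (eta * nu * z t v) <=
    - (eta * \sum_v c v * m t v).
  have s_all x : x \in sigma t by rewrite (perm_mem (orderBy_perm _ _)) mem_enum.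
  have le0 : eta * (Rr * lam)^-1 * \sum_v c v * (lam - (qord e (sigma t) v)%:R) <= 0.
    by rewrite mulr_ge0_le0 ?copt// mulr_ge0 ?invr_ge0 ?mulr_ge0// ltW.
  have -> : eta * \sum_v c v * m t v =
      eta * (Rr * lam)^-1 * (\sum_v c v * (lam - (qord e (sigma t) v)%:R)) +
      \sum_v c v * (eta * nu * z t v).
    rewrite !mulr_sumr -big_split/=; apply: eq_bigr => v _.
    by rewrite -[m t v]/(meanCost (sigma t) v + nu * z t v) meanCostE; ring.
  have : \sum_v c v * (1 + eta * nu * z t v) <=
      \sum_v c v * expR (eta * nu * z t v).
    by apply: ler_sum => v _; rewrite ler_wpM2l ?expR_ge1Dx.
  under eq_bigr do rewrite mulrDr mulr1.
  by rewrite big_split/= c1; lra.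
have upper t : \sum_v normalize (W t) v * expR (- (eta * m t v)) =
    \sum_v p t v * expR (- (eta * meanCost (sigma t) v)) *
      expR (- (eta * nu) * z t v).
  apply: eq_bigr => v _; rewrite -mulrA -expRD; congr (_ * expR _).
  by rewrite -[m t v]/(meanCost (sigma t) v + nu * z t v); ring.
rewrite mulr_sumr -sumrN => H.
have := le_trans (ler_sum _ (fun (t : 'I_T) _ => lower t)) H.
under [in X in _ <= X -> _]eq_bigr do rewrite upper.
rewrite !big_split/= !sumrN !sumr_const card_ord.
by lra.
Qed.

End PathwiseBounds.

Section NoiselessUpdate.
Variables (R : realType) (V : finType) (e : rel V) (rk : V -> nat) (v0 : V).
Variables (Rr nu eta : R).
Local Notation lam := (@maxDensity R V e).

(** The part of a vertex's contribution to the update of round [t] that is fixed before the noise of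
    that round is drawn. *)
Definition noiselessUpdate (z : nat -> V -> R) (t : nat) (v : V) : R :=
  mwuP e rk lam Rr nu eta z t v *
  expR (- (eta * meanCost e Rr (mwuSigma e rk lam Rr nu eta z t) v)).

Lemma noiselessUpdate_ge0 z t v : 0 <= noiselessUpdate z t v.
Proof. by rewrite mulr_ge0 ?expR_ge0// mwuP_ge0. Qed.

Lemma measurable_noiselessUpdate d (T0 : measurableType d)
    (z : T0 -> nat -> V -> R) t v :
  (forall s u, (s < t)%N -> measurable_fun setT (fun w => z w s u)) ->
  measurable_fun setT (fun w => noiselessUpdate (z w) t v).
Proof.
move=> mz; apply: measurable_funM; first exact: measurable_mwuP.
apply: measurableT_comp => //; apply: measurableT_comp => //.
apply: measurable_funM => //; apply: measurable_funM => //.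
apply: measurable_funB => //; apply: measurable_funM => //.
exact: measurable_qord_mwuSigma.
Qed.

End NoiselessUpdate.

(** Here [h] stands for [eta ^+ 2], [K] for the noise factor and [G] for the expected number of good
    rounds. If [G < T / 2], the inner bracket is at most [(1 - 6 * h) * T], so the right-hand side
    is at most [(h + (1 + h) * (2 - 6 * h)) * T = (2 - 3 * h - 6 * h ^+ 2) * T], which is below
    [2 * T]. *)
Lemma half_le_of_regret (R : realType) (h K T G : R) :
  0 < h -> h <= 256^-1 -> 0 < K -> K <= 1 + h -> 0 < T ->
  2 * T <= T * h + (K * T + K * ((1 - 14 * h) * T + 16 * h * G)) -> T / 2 <= G.
Proof.
move=> h0 h256 K0 Kh T0 H; rewrite leNgt; apply/negP => GT.
have hG : h * G <= h * (T / 2) by rewrite ler_pM2l// ltW.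
have hT : 0 < T * h by rewrite mulr_gt0.
have hhT : 0 < T * h * h by rewrite mulr_gt0.
have U0 : 0 <= (1 - 6 * h) * T by rewrite mulr_ge0 ?(ltW T0)//; lra.
have K1 : K * ((1 - 14 * h) * T + 16 * h * G) <= K * ((1 - 6 * h) * T).
  by rewrite ler_pM2l//; lra.
have K2 := ler_wpM2r U0 Kh.
have K3 := ler_wpM2r (ltW T0) Kh.
by lra.
Qed.

(** * Expectations and the number of good rounds *)

Section NoisyProcess.
Variables (R : realType) (V : finType) (e : rel V).
Hypotheses (e_sym : symmetric e) (e_irr : irreflexive e).
Variables (rk : V -> nat) (v0 : V) (Rr nu eta : R).
Local Notation n := (#|V|%:R : R).
Local Notation lam := (@maxDensity R V e).
Hypotheses (lam_gt0 : 0 < lam) (Rr_gt0 : 0 < Rr) (Rr_large : n <= Rr * lam).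
Hypotheses (eta_gt0 : 0 < eta) (eta_small : eta <= 16^-1).
Hypotheses (nu_ge0 : 0 <= nu) (nu_le1 : nu <= 1).
Context d (Omega : measurableType d) (P : probability Omega R).
Variables (T : nat) (Z : nat -> V -> {RV P >-> R}).
Hypothesis Z_normal : forall t v, (t < T)%N -> forall A : set R, measurable A ->
  distribution P (Z t v) A = normal_prob 0 1 A.
Hypothesis Z_indep :
  mutually_independent P (fun i : 'I_T * V => (Z i.1 i.2 : Omega -> R)).

Local Notation z w := (fun t v => Z t v w).
Local Notation sigma w := (mwuSigma e rk lam Rr nu eta (z w)).
Local Notation upd := (noiselessUpdate e rk Rr nu eta).

Let measurable_upd t v : measurable_fun setT (fun w => upd (z w) t v).
Proof. by apply: measurable_noiselessUpdate => // s u _; exact: measurable_funP. Qed.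

Let measurable_expR_noise (s : R) t v :
  measurable_fun setT (fun w => expR (s * Z t v w)).
Proof. by apply: measurableT_comp => //; exact: measurable_funM. Qed.

(* The noiseless update of round t only depends on the noise of earlier rounds. *)
Lemma expectation_noisy_update (s : R) t v : (t < T)%N ->
  (\int[P]_w (upd (z w) t v * expR (s * Z t v w))%:E =
   (expR (s ^+ 2 / 2))%:E * \int[P]_w (upd (z w) t v)%:E)%E.
Proof.
move=> tT; rewrite ge0_expectation_mul_indep//.
- by rewrite (standard_normal_mgf _ (Z_normal v tT)) muleC.
- by move=> w; exact: noiselessUpdate_ge0.
move=> A B mA mB.
pose X (i : 'I_T * V) := Z i.1 i.2.
pose J := [set i : 'I_T * V | (i.1 < t)%N]%SET.
have mg : measurable_fun setT (fun x : R => expR (s * x)) by exact: measurableT_comp.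
have mgB : measurable ((fun x : R => expR (s * x)) @^-1` B).
  by rewrite -[_ @^-1` _]setTI; exact: mg.
apply: (@indep_sigma_cylinders _ _ _ _ _ X Z_indep J (Ordinal tT, v) _ _ _ _ mgB).
  by rewrite inE ltnn.
(* Measurability is applied on [Omega] with the sigma-algebra of the earlier noise, so the preimage
   of [A] is an event of that sigma-algebra. *)
have := @measurable_noiselessUpdate R V e rk Rr nu eta _
  (g_sigma_algebraType (cylinders X J)) (fun w => z w) t v.
move=> /(_ _ measurableT A mA); rewrite setTI; apply.
move=> r u rt _ C mC; rewrite setTI.
have rT := ltn_trans rt tT.
by apply: (@sigma_cylinders_RV _ _ _ _ _ X J (Ordinal rT, u)); rewrite ?inE.
Qed.

Local Notation alpha := (8 * Rr * eta).

(** Quantifying over every [S] makes the event independent of how ties between densest prefixes are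
    resolved. *)
Definition goodRound (t : nat) : set Omega :=
  [set w | forall S : {set V}, isMaxPrefix R e (sigma w t) S ->
     (1 - 2 * alpha) * lam <= density R e S].

Lemma measurable_goodRound t : measurable (goodRound t).
Proof.
apply: (measurable_mwuSigma (z := fun w => z w) e rk lam Rr nu eta (t := t) _
  (fun s => forall S : {set V}, isMaxPrefix R e s S ->
     (1 - 2 * alpha) * lam <= density R e S)).
by move=> s v _; exact: measurable_funP.
Qed.

(** In a good round [D = lam] gives [1 + 2 * eta ^+ 2]. In a bad round some densest prefix falls
    short of [lam] by more than [2 * alpha * lam], which saves
    [eta / Rr * (2 * alpha) = 16 * eta ^+ 2]. *)
Lemma sum_update_le w t :
  \sum_v upd (z w) t v <= 1 - 14 * eta ^+ 2 + 16 * eta ^+ 2 * \1_(goodRound t) w.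
Proof.
have bound D : (forall x, density R e (prefixSet (sigma w t) x) <= D) ->
    \sum_v upd (z w) t v <= 1 + 2 * eta ^+ 2 - eta * (Rr * lam)^-1 * (lam - D).
  apply: (round_update_le e_sym e_irr v0) => //.
  - exact: orderBy_perm.
  - exact: orderBy_sorted.
  - by move=> v; exact: mwuP_ge0.
  - exact: mwuP_sum1.
rewrite indicE; have [_|/negP] := boolP (w \in goodRound t).
  apply: le_trans (bound lam _) _; last by rewrite subrr mulr0 /= mulr1; lra.
  by move=> x; apply: density_le_max; exact: prefixSet_neq0.
rewrite inE => /existsNP[S /not_implyP[[_ Smax] /negP]]; rewrite -ltNge => Sbad.
apply: le_trans (bound _ Smax) _.
have RL : 0 < Rr * lam by rewrite mulr_gt0.
have : 16 * eta ^+ 2 <= eta * (Rr * lam)^-1 * (lam - density R e S).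
  have -> : 16 * eta ^+ 2 = eta * (Rr * lam)^-1 * (2 * alpha * lam).
    by field; rewrite !gt_eqF.
  apply: ler_wpM2l; first by rewrite mulr_ge0 ?invr_ge0 ?(ltW eta_gt0) ?(ltW RL).
  by lra.
by rewrite mulr0; lra.
Qed.

Let eta_sqr_le : eta ^+ 2 <= 256^-1.
Proof.
have : eta ^+ 2 <= 16^-1 ^+ 2 by rewrite ler_pXn2r// ?nnegrE ?invr_ge0// ltW.
by rewrite expr2; lra.
Qed.

Let eta_sqr_gt0 : 0 < eta ^+ 2. Proof. by rewrite exprn_gt0. Qed.

Local Notation k := (expR ((eta * nu) ^+ 2 / 2)).

(** With [x = (eta * nu) ^+ 2], the quadratic bound at [x / 2] reads [1 + x / 2 + x ^+ 2 / 2], and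
    [x ^+ 2] is at most [eta ^+ 2 / 256]. *)
Let k_le : k <= 1 + eta ^+ 2.
Proof.
have nu2 : nu ^+ 2 <= 1 by rewrite expr_le1.
have s2 : (eta * nu) ^+ 2 <= eta ^+ 2 by rewrite exprMn ler_piMr// ltW.
have s0 := sqr_ge0 (eta * nu).
have := eta_sqr_le; have := eta_sqr_gt0.
set h := eta ^+ 2 in s2 *; set x := (eta * nu) ^+ 2 in s2 s0 *.
move=> h0 hs; have x2 : x / 2 <= 2^-1 by lra.
apply: le_trans (expR_le_quadratic x2) _.
have : x ^+ 2 <= h * 256^-1 by rewrite expr2 ler_pM//; lra.
by lra.
Qed.

Let integral_cstP (r : \bar R) : (\int[P]_(_ in setT) r = r)%E.
Proof.
rewrite integral_cst// -[RHS]mule1; congr (_ * _)%E; exact: probability_setT.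
Qed.

Lemma expectation_sum_noisy_update_le t : (t < T)%N ->
  (\int[P]_w (\sum_v upd (z w) t v * expR (- (eta * nu) * Z t v w))%:E <=
   k%:E * ((1 - 14 * eta ^+ 2)%:E + (16 * eta ^+ 2)%:E * P (goodRound t)))%E.
Proof.
move=> tT; under eq_integral do rewrite -sumEFin.
rewrite ge0_integral_sum//; last 2 first.
- by move=> v; apply/measurable_EFinP; exact: measurable_funM.
- by move=> v w _; rewrite lee_fin mulr_ge0 ?expR_ge0// noiselessUpdate_ge0.
(* The noise factor depends only on the square of the coefficient, so the minus sign disappears and
   the same [k] factors out for all vertices. *)
under eq_bigr => v _ do rewrite expectation_noisy_update// sqrrN.
rewrite -ge0_sume_distrr; last first.
  by move=> v _; apply: integral_ge0 => w _; rewrite lee_fin noiselessUpdate_ge0.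
rewrite lee_pmul2l ?lte_fin ?expR_gt0//.
rewrite -ge0_integral_sum//; last 2 first.
- by move=> v; exact/measurable_EFinP.
- by move=> v w _; rewrite lee_fin noiselessUpdate_ge0.
have mG := measurable_goodRound t.
have h := eta_sqr_le; have h0 := eta_sqr_gt0.
apply: (@le_trans _ _ (\int[P]_w ((1 - 14 * eta ^+ 2)%:E +
    (16 * eta ^+ 2)%:E * (\1_(goodRound t) w)%:E))%E).
  apply: ge0_le_integral => //.
  - by move=> w _; apply: sume_ge0 => v _; rewrite lee_fin noiselessUpdate_ge0.
  - by apply: emeasurable_sum => v; exact/measurable_EFinP.
  - apply: emeasurable_funD => //; apply: measurable_funeM.
    exact/measurable_EFinP.
  - by move=> w _; rewrite sumEFin -EFinM -EFinD lee_fin sum_update_le.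
(* Splitting the integral uses [0 <= 1 - 14 * eta ^+ 2], which holds because
   [eta ^+ 2 <= 256^-1]. *)
rewrite ge0_integralD//.
- rewrite integral_cstP leeD2l//.
  rewrite ge0_integralZl//; first by rewrite integral_indic// setIT.
  + exact/measurable_EFinP.
  + by rewrite lee_fin mulr_ge0// ltW.
- by move=> w _; rewrite lee_fin; lra.
- by move=> w _; rewrite -EFinM lee_fin mulr_ge0// mulr_ge0// ltW.
- by apply: measurable_funeM; exact/measurable_EFinP.
Qed.

Hypothesis T_gt0 : (0 < T)%N.
Hypothesis T_eta : T%:R * eta ^+ 2 = ln n.

(** The pathwise regret inequality is integrated for the weights of a densest set: the comparison
    term has mean [k] in each round, the update term is bounded through the probability of a good
    round, and [ln n] equals [T%:R * eta ^+ 2]. *)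
Lemma sum_goodRound_ge : ((T%:R / 2)%:E <= \sum_(t < T) P (goodRound t))%E.
Proof.
have [c [c0 c1 copt]] := densest_weights R e_sym e_irr v0.
pose f (t : nat) w := \sum_v c v * expR (eta * nu * Z t v w).
pose g (t : nat) w := \sum_v upd (z w) t v * expR (- (eta * nu) * Z t v w).
have f0 t w : 0 <= f t w.
  by apply: sumr_ge0 => v _; rewrite mulr_ge0// expR_ge0.
have g0 t w : 0 <= g t w.
  by apply: sumr_ge0 => v _; rewrite mulr_ge0 ?expR_ge0// noiselessUpdate_ge0.
have mf t : measurable_fun setT (f t).
  by apply: measurable_sum => v; exact: measurable_funM.
have mg t : measurable_fun setT (g t).
  by apply: measurable_sum => v; exact: measurable_funM.
have ln0 : 0 <= ln n by rewrite -T_eta mulr_ge0// ltW.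
have pathwise w : 2 * T%:R <= ln n + \sum_(t < T) (f t w + g t w).
  exact: mwu_pathwise_regret.
have intf t : (t < T)%N -> (\int[P]_w (f t w)%:E = k%:E)%E.
  move=> tT; rewrite /f; under eq_integral do rewrite -sumEFin.
  rewrite ge0_integral_sum//; last 2 first.
  - by move=> v; apply/measurable_EFinP; exact: measurable_funM.
  - by move=> v w _; rewrite lee_fin mulr_ge0// expR_ge0.
  transitivity (\sum_v (c v * k)%:E)%E; last first.
    by rewrite sumEFin -mulr_suml c1 mul1r.
  apply: eq_bigr => v _; under eq_integral do rewrite EFinM.
  rewrite ge0_integralZl//; first by rewrite (standard_normal_mgf _ (Z_normal v tT)).
  - exact/measurable_EFinP.
  - by rewrite lee_fin.
have : ((2 * T%:R)%:E <= \int[P]_w (ln n + \sum_(t < T) (f t w + g t w))%:E)%E.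
  rewrite -[leLHS]integral_cstP; apply: ge0_le_integral => //.
  - apply/measurable_EFinP; apply: measurable_funD => //.
    by apply: measurable_sum => t; exact: measurable_funD.
  - by move=> w _; rewrite lee_fin.
under eq_integral do rewrite EFinD -sumEFin.
rewrite ge0_integralD//; last 2 first.
- by move=> w _; apply: sume_ge0 => t _; rewrite lee_fin addr_ge0.
- by apply: emeasurable_sum => t; apply/measurable_EFinP; exact: measurable_funD.
rewrite integral_cstP.
rewrite ge0_integral_sum//; last 2 first.
- by move=> t; apply/measurable_EFinP; exact: measurable_funD.
- by move=> t w _; rewrite lee_fin addr_ge0.
pose pg t := fine (P (goodRound t)).
have pgE t : P (goodRound t) = (pg t)%:E.
  by rewrite fineK// fin_num_measure//; exact: measurable_goodRound.
have round (t : 'I_T) : (\int[P]_w (f t w + g t w)%:E <=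
    (k + k * (1 - 14 * eta ^+ 2 + 16 * eta ^+ 2 * pg t))%:E)%E.
  under eq_integral do rewrite EFinD.
  rewrite ge0_integralD//; last 4 first.
  - by move=> w _; rewrite lee_fin.
  - exact/measurable_EFinP.
  - by move=> w _; rewrite lee_fin.
  - exact/measurable_EFinP.
  rewrite intf// EFinD leeD2l//.
  by have := expectation_sum_noisy_update_le (ltn_ord t); rewrite pgE.
move=> H; have {H} := le_trans H (leeD2l _ (lee_sum _ (fun t _ => round t))).
rewrite sumEFin -EFinD lee_fin.
under [in X in _ -> (_ <= X)%E]eq_bigr do rewrite pgE.
rewrite sumEFin lee_fin big_split/= sumr_const card_ord -mulr_sumr big_split/=.
rewrite sumr_const card_ord -mulr_sumr -T_eta.
rewrite -[k *+ T]mulr_natr -[(_ - _) *+ T]mulr_natr.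
apply: half_le_of_regret => //; first exact: expR_gt0.
by rewrite ltr0n.
Qed.

End NoisyProcess.

Unset Implicit Arguments.
Set Strict Implicit.

Theorem mainTheorem7 (R : realType) (V : finType) (e : rel V)
    (e_sym : symmetric e) (e_irr : irreflexive e)
    (n_ge2 : (2 <= #|V|)%N) (has_edge : exists u v, e u v)
    (rk : V -> nat) (rk_inj : injective rk)
    (T : nat) (T_ge1 : (1 <= T)%N) (tau : R) (tau_gt0 : 0 < tau)
    (d : measure_display) (Omega : measurableType d) (P : probability Omega R)
    (Z : nat -> V -> {RV P >-> R})
    (Z_normal : forall t v, (t < T)%N -> forall A : set R, measurable A ->
        distribution P (Z t v) A = normal_prob 0 1 A)
    (Z_indep : mutually_independent P (fun i : 'I_T * V => (Z i.1 i.2 : Omega -> R))) :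
  let n : R := (#|V|)%:R in
  let lam := maxDensity R e in
  let Rr := (n + tau) / lam in
  let nu := tau / (Rr * lam) in
  let eta := Num.sqrt (ln n / T%:R) in
  let alpha := 8 * Rr * Num.sqrt (ln n / T%:R) in
  let z (w : Omega) : nat -> V -> R := fun t v => Z t v w in
  (* the returned sigma is the ordering of V in nonincreasing order of the returned p *)
  (forall (w : Omega) (t : nat),
     let p := mwuP e rk lam Rr nu eta (z w) t in
     let s := mwuSigma e rk lam Rr nu eta (z w) t in
     perm_eq s (enum V) /\ sorted (fun u v => p v <= p u) s) /\
  (* with probability >= 1/2 over the noise and the uniform choice of t in [T] *)
  ((1 / 2)%:E <=
   ((T%:R)^-1)%:E *
     \sum_(t < T)
       P [set w | forall S : {set V},
             isMaxPrefix R e (mwuSigma e rk lam Rr nu eta (z w) t) S ->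
             ((1 - 2 * alpha) * lam <= density R e S)%R])%E.
Proof.
move=> n lam Rr nu eta alpha z; split.
  by move=> w t p s; split; [exact: orderBy_perm|exact: orderBy_sorted].
have [v0 [u1 e01]] := has_edge.
have lam_gt0 : 0 < lam by exact: maxDensity_gt0 e01.
have lam_le : lam <= n by exact: maxDensity_le_card.
have n_gt0 : 0 < n by exact: lt_le_trans lam_le.
have nt_gt0 : 0 < n + tau by exact: addr_gt0.
have Rr_gt0 : 0 < Rr by exact: divr_gt0.
(* This identity yields both [n <= Rr * lam] and [nu = tau / (n + tau) <= 1]. *)
have RrE : Rr * lam = n + tau by rewrite /Rr divfK ?gt_eqF.
have T_gt0 : 0 < T%:R :> R by rewrite ltr0n.
have ln_gt0 : 0 < ln n by rewrite ln_gt0// ltr1n.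
have eta_gt0 : 0 < eta by rewrite sqrtr_gt0 divr_gt0.
have T_eta : T%:R * eta ^+ 2 = ln n.
  by rewrite /eta sqr_sqrtr ?divr_ge0 1?ltW// mulrC divfK ?gt_eqF.
have alphaE : alpha = 8 * Rr * eta by [].
suff sumP : ((T%:R / 2)%:E <= \sum_(t < T) P (goodRound e rk Rr nu eta Z t))%E.
  have := lee_wpmul2l (_ : 0%:E <= (T%:R^-1)%:E)%E sumP.
  rewrite -EFinM mulrA mulVf ?gt_eqF// lee_fin invr_ge0 ler0n.
  exact.
(* The regret argument covers small [eta]. Otherwise [Rr >= 1] gives [alpha > 1 / 2], the threshold
   [(1 - 2 * alpha) * lam] is negative, and every round is good. *)
have [eta_small|eta_large] := leP eta 16^-1.
  apply: (@sum_goodRound_ge R V e e_sym e_irr rk v0 Rr nu eta) => //.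
  - by rewrite RrE lerDl ltW.
  - by rewrite /nu RrE divr_ge0 ?ltW.
  - by rewrite /nu RrE ler_pdivrMr// mul1r lerDr ltW.
have goodT t : goodRound e rk Rr nu eta Z t = setT.
  apply/seteqP; split=> // w _ S _; apply: le_trans (density_ge0 _ _ _).
  have Rr1 : 1 <= Rr by rewrite /Rr ler_pdivlMr// mul1r; lra.
  have : eta <= Rr * eta by rewrite ler_peMl// ltW.
  by move=> ?; rewrite mulr_le0_ge0// ?ltW//; lra.
under eq_bigr do rewrite goodT probability_setT.
rewrite sumEFin sumr_const card_ord lee_fin.
by lra.
Qed.
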